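(* For the unconstrained optimal trajectory $(p_i,v_i,u_i)$ of vehicle $i$ on $[t_i^0,t_i^m]$: (i) The state constraint $v_{min}-v_i(t)\le 0$ and the control constraint $u_{min}-u_i(t)\le 0$ are not activated if $v_i(t_i^0)<\dfrac{p_i(t_i^m)-p_i(t_i^0)}{t_i^m}$. (ii) The state constraint $v_i(t)-v_{max}\le 0$ and the control constraint $u_i(t)-u_{max}\le 0$ are not activated if $v_i(t_i^0)>\dfrac{p_i(t_i^m)-p_i(t_i^0)}{t_i^m}$.
   Context: A vehicle $i$ is a double integrator $\dot p_i=v_i$, $\dot v_i=u_i$, with position $p_i$, speed $v_i$ and control (acceleration) $u_i$. It enters a control zone at time $t_i^0$ and reaches the end of it at the fixed time $t_i^m>t_i^0$ (times are in $\mathbb{R}^+$). The data $t_i^0$, $p_i(t_i^0)=0$, $v_i(t_i^0)$, $t_i^m$ and $p_i(t_i^m)$ are given; the terminal speed $v_i(t_i^m)$ is not prescribed. The vehicle is to minimize $\int_{t_i^0}^{t_i^m}\tfrac12 u_i(t)^2\,dt$ subject to the dynamics, these boundary data, and the constraints $u_{min}\le u_i(t)\le u_{max}$ and $0\le v_{min}\le v_i(t)\le v_{max}$, where $u_{min},u_{max}$ are the minimum and maximum acceleration and $v_{min},v_{max}$ the minimum and maximum speed limits. The unconstrained optimal trajectory is the solution obtained when these speed and control bounds are not imposed; it has the form $u_i(t)=a_it+b_i$, $v_i(t)=\tfrac12a_it^2+b_it+c_i$, $p_i(t)=\tfrac16a_it^3+\tfrac12b_it^2+c_it+d_i$ with real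 constants $a_i,b_i,c_i,d_i$. A constraint is activated by a trajectory if its bound is reached or exceeded at some time in $[t_i^0,t_i^m]$.
   Formalization: In (ii) the denominator t_i^m is replaced by t_i^m − t_i^0 (false otherwise if t_i^0>0); u_min<0<u_max and v_min ≤ v_i(t_i^0) ≤ v_max are assumed, and the speed claims need v_i(t_i^0)>v_min in (i) and v_i(t_i^0)<v_max in (ii), since reaching a bound counts as activation. *)

(* Defs.v *)
From Stdlib Require Import Reals.
From Coquelicot Require Import Coquelicot.
Open Scope R_scope.

(* The derivatives are required on the open interval only; continuity on the
   closed interval makes the end-point values of p, v and u the one-sided
   limits.  Only continuous controls compete: the optimal control is affine in
   time, so it also minimizes the cost within this class, and fewer competitors
   make optimality the weaker requirement. *)
Record admissible (t0 tm v0 pm : R) (p v u : R -> R) : Prop := {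
  adm_p_cont : continuous_on (fun t => t0 <= t <= tm) p;
  adm_v_cont : continuous_on (fun t => t0 <= t <= tm) v;
  adm_u_cont : continuous_on (fun t => t0 <= t <= tm) u;
  adm_p_dyn : forall t, t0 < t < tm -> is_derive p t (v t);
  adm_v_dyn : forall t, t0 < t < tm -> is_derive v t (u t);
  adm_p_init : p t0 = 0;
  adm_v_init : v t0 = v0;
  adm_p_final : p tm = pm
}.

Definition cost (t0 tm : R) (u : R -> R) : R :=
  RInt (fun t => / 2 * (u t) ^ 2) t0 tm.

Definition unconstrained_optimal (t0 tm v0 pm : R) (p v u : R -> R) : Prop :=
  admissible t0 tm v0 pm p v u /\
  forall p' v' u' : R -> R,
    admissible t0 tm v0 pm p' v' u' -> cost t0 tm u <= cost t0 tm u'.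

(* The constraint is g t <= 0, so 0 <= g t says that its bound is reached
   (equality) or exceeded at time t. *)
Definition activated (t0 tm : R) (g : R -> R) : Prop :=
  exists t : R, t0 <= t <= tm /\ 0 <= g t.

(* Main.v *)
(** The control [w t = K (tm - t)], with [K] fixed by the boundary data, is
    admissible.  Every admissible control [u] satisfies
    [int u w = K (pm - v0 (tm - t0))], because [K ((tm - t) v + p)] is an
    antiderivative of [u w]; hence [int (u - w)^2 = int u^2 - int w^2], so an
    optimal [u] equals [w].  Its sign on [[t0, tm)] is that of
    [pm - v0 (tm - t0)], which decides all four constraints. *)
Require Import Defs.
From Stdlib Require Import Reals Lra.
From Coquelicot Require Import Coquelicot.
Open Scope R_scope.

(** * Extension of functions from a closed interval to the whole line *)

(** Precomposition with this retraction onto [[a, b]] freezes a function at its end-point values, so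
    that functions known only on the closed interval can enter lemmas that ask for continuity
    everywhere. *)
Definition clamp (a b x : R) : R := Rmax a (Rmin b x).

Lemma clamp_between (a b x : R) : a <= b -> a <= clamp a b x <= b.
Proof.
  intros hab; unfold clamp, Rmax, Rmin.
  repeat destruct (Rle_dec _ _); lra.
Qed.

Lemma clamp_id (a b x : R) : a <= x <= b -> clamp a b x = x.
Proof.
  intros hx; unfold clamp, Rmax, Rmin.
  repeat destruct (Rle_dec _ _); lra.
Qed.

Lemma clamp_dist (a b x y : R) : Rabs (clamp a b y - clamp a b x) <= Rabs (y - x).
Proof.
  unfold clamp, Rmax, Rmin.
  repeat destruct (Rle_dec _ _); unfold Rabs; repeat destruct (Rcase_abs _); lra.
Qed.

(** [clamp a b] is 1-Lipschitz with values in [[a, b]], so a radius valid for [f] within the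
    interval at [clamp a b x] is valid at [x]. *)
Lemma continuous_clamp (a b : R) (f : R -> R) (x : R) : a <= b ->
  continuous_on (fun t => a <= t <= b) f ->
  continuous (fun t => f (clamp a b t)) x.
Proof.
  intros hab hf P hP.
  destruct (hf (clamp a b x) (clamp_between a b x hab) P hP) as [d hd].
  exists d; intros y hy; apply hd.
  - apply Rle_lt_trans with (2 := hy); exact (clamp_dist a b x y).
  - exact (clamp_between a b y hab).
Qed.

Lemma is_derive_clamp (a b : R) (f : R -> R) (x l : R) : a < x < b ->
  is_derive f x l -> is_derive (fun t => f (clamp a b t)) x l.
Proof.
  intros hx; apply is_derive_ext_loc.
  apply locally_interval with a b; simpl; try lra.
  intros y hay hyb; rewrite clamp_id; [reflexivity | lra].
Qed.

(** * Integrals of continuous functions *)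

Lemma is_derive_RInt_continuous (f : R -> R) (a x : R) :
  (forall y, continuous f y) -> is_derive (fun t => RInt f a t) x (f x).
Proof.
  intros hf; apply is_derive_RInt with a; [| apply hf].
  apply filter_forall; intros y.
  apply (@RInt_correct R_CompleteNormedModule), ex_RInt_continuous; intros; apply hf.
Qed.

(** The mean value theorem needs derivatives only inside the interval. Applied to [f] minus the
    primitive of [df], whose derivative there is 0, it gives equal values at [a] and [b]. *)
Lemma RInt_derive_open (f df : R -> R) (a b : R) : a <= b ->
  (forall x, continuous f x) -> (forall x, continuous df x) ->
  (forall x, a < x < b -> is_derive f x (df x)) ->
  RInt df a b = f b - f a.
Proof.
  intros hab hf hdf hd.
  destruct (MVT_gen (fun t => f t - RInt df a t) a b (fun _ => 0)) as [c [_ hc]].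
  - intros x; rewrite Rmin_left, Rmax_right by lra; intros hx.
    replace 0 with (minus (df x) (df x)) by (unfold minus, plus, opp; simpl; ring).
    apply (is_derive_minus (V := R_NormedModule)); [now apply hd |].
    now apply is_derive_RInt_continuous.
  - intros x _; apply continuity_pt_filterlim.
    apply (continuous_minus (V := R_NormedModule)); [apply hf |].
    apply (ex_derive_continuous (V := R_NormedModule)).
    exists (df x); now apply is_derive_RInt_continuous.
  - rewrite RInt_point in hc; unfold zero in hc; simpl in hc; lra.
Qed.

(** The primitive from [a] vanishes on all of [[a, b]], while its derivative at [x] is [f x]; a
    difference quotient equal to 0 then contradicts [f x > 0]. *)
Lemma RInt_nonneg_eq0 (f : R -> R) (a b : R) : a < b ->
  (forall x, continuous f x) -> (forall x, 0 <= f x) -> RInt f a b <= 0 ->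
  forall x, a <= x <= b -> f x = 0.
Proof.
  intros hab hf hpos hint x hx.
  assert (hex : forall c d, ex_RInt f c d)
    by (intros; apply (ex_RInt_continuous (V := R_CompleteNormedModule)); auto).
  assert (hconst : forall t, a <= t <= b -> RInt f a t = 0).
  { intros t ht.
    pose proof (RInt_Chasles f a t b (hex _ _) (hex _ _)) as hch.
    unfold plus in hch; simpl in hch.
    assert (0 <= RInt f a t) by (apply RInt_ge_0; auto; lra).
    assert (0 <= RInt f t b) by (apply RInt_ge_0; auto; lra).
    lra. }
  destruct (Rle_lt_or_eq_dec _ _ (hpos x)) as [hlt | heq]; [exfalso | now symmetry].
  pose proof (is_derive_RInt_continuous f a x hf) as hder.
  apply is_derive_Reals in hder.
  destruct (hder (f x) hlt) as [d hd].
  pose proof (cond_pos d) as hd0.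
  (* The increment points towards the farther end of the interval, so that [x] may be an end
     point. *)
  assert (hh : exists h, h <> 0 /\ Rabs h < d /\ a <= x + h <= b).
  { pose (m := Rmin (d / 2) ((b - a) / 2)).
    assert (0 < m) by (apply Rmin_pos; lra).
    assert (m <= d / 2) by apply Rmin_l.
    assert (m <= (b - a) / 2) by apply Rmin_r.
    destruct (Rle_dec x ((a + b) / 2)); [exists m | exists (- m)];
      (repeat split; try lra; apply Rabs_def1; lra). }
  destruct hh as [h [h0 [hhd hxh]]].
  specialize (hd h h0 hhd).
  rewrite !hconst in hd by assumption.
  replace ((0 - 0) / h - f x) with (- f x) in hd by (field; assumption).
  rewrite Rabs_Ropp, Rabs_pos_eq in hd; lra.
Qed.

(** * The explicit optimal trajectory *)

(** The constant [K] solving [v0 * (tm - t0) + K * (tm - t0) ^ 3 / 3 = pm], the terminal position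
    condition. *)
Definition opt_slope (t0 tm v0 pm : R) : R :=
  3 * (pm - v0 * (tm - t0)) / (tm - t0) ^ 3.

(** Vanishing at [tm] is the transversality condition of the free terminal speed. *)
Definition opt_u (t0 tm v0 pm t : R) : R := opt_slope t0 tm v0 pm * (tm - t).

Definition opt_v (t0 tm v0 pm t : R) : R :=
  v0 + opt_slope t0 tm v0 pm * ((tm - t0) ^ 2 - (tm - t) ^ 2) / 2.

Definition opt_p (t0 tm v0 pm t : R) : R :=
  v0 * (t - t0) + opt_slope t0 tm v0 pm *
    ((tm - t0) ^ 2 * (t - t0) + ((tm - t) ^ 3 - (tm - t0) ^ 3) / 3) / 2.

Lemma is_derive_opt_p (t0 tm v0 pm t : R) :
  is_derive (opt_p t0 tm v0 pm) t (opt_v t0 tm v0 pm t).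
Proof.
  unfold opt_p, opt_v; auto_derive; [exact I | field].
Qed.

Lemma is_derive_opt_v (t0 tm v0 pm t : R) :
  is_derive (opt_v t0 tm v0 pm) t (opt_u t0 tm v0 pm t).
Proof.
  unfold opt_v, opt_u; auto_derive; [exact I | field].
Qed.

Lemma continuous_opt_u (t0 tm v0 pm t : R) : continuous (opt_u t0 tm v0 pm) t.
Proof.
  apply (ex_derive_continuous (V := R_NormedModule)).
  unfold opt_u; auto_derive; exact I.
Qed.

Lemma opt_admissible (t0 tm v0 pm : R) : t0 < tm ->
  admissible t0 tm v0 pm
    (opt_p t0 tm v0 pm) (opt_v t0 tm v0 pm) (opt_u t0 tm v0 pm).
Proof.
  intros htm; split.
  - apply continuous_on_forall; intros x _.
    apply (ex_derive_continuous (V := R_NormedModule)).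
    eexists; apply is_derive_opt_p.
  - apply continuous_on_forall; intros x _.
    apply (ex_derive_continuous (V := R_NormedModule)).
    eexists; apply is_derive_opt_v.
  - apply continuous_on_forall; intros x _; apply continuous_opt_u.
  - intros t _; apply is_derive_opt_p.
  - intros t _; apply is_derive_opt_v.
  - unfold opt_p; field.
  - unfold opt_v; field.
  - unfold opt_p, opt_slope; field; lra.
Qed.

(** * Uniqueness of the optimal control and speed *)

(** The factor [tm - t] removes the unknown terminal speed from the boundary terms, so the value is
    the same for every competitor. *)
Lemma RInt_mul_opt_u (t0 tm v0 pm : R) (p v u : R -> R) : t0 < tm ->
  admissible t0 tm v0 pm p v u ->
  RInt (fun t => u (clamp t0 tm t) * opt_u t0 tm v0 pm t) t0 tm =
  opt_slope t0 tm v0 pm * (pm - v0 * (tm - t0)).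
Proof.
  intros htm [hp hv hu hdp hdv hp0 hv0 hpm].
  assert (hle : t0 <= tm) by lra.
  pose (k := opt_slope t0 tm v0 pm).
  etransitivity;
    [apply (RInt_derive_open (fun t => k * ((tm - t) * v (clamp t0 tm t) + p (clamp t0 tm t)))) |].
  - exact hle.
  - intros x; apply (continuous_scal_r (V := R_NormedModule)).
    apply (continuous_plus (V := R_NormedModule)); [| now apply continuous_clamp].
    apply (continuous_mult (K := R_AbsRing)); [| now apply continuous_clamp].
    apply (ex_derive_continuous (V := R_NormedModule)); auto_derive; exact I.
  - intros x; apply (continuous_mult (K := R_AbsRing));
      [now apply continuous_clamp | apply continuous_opt_u].
  - intros x hx.
    pose proof (is_derive_clamp t0 tm p x _ hx (hdp x hx)) as hdP.
    pose proof (is_derive_clamp t0 tm v x _ hx (hdv x hx)) as hdV.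
    set (P := fun t => p (clamp t0 tm t)) in *.
    set (V := fun t => v (clamp t0 tm t)) in *.
    change (is_derive (fun t => k * ((tm - t) * V t + P t)) x
      (u (clamp t0 tm x) * opt_u t0 tm v0 pm x)).
    auto_derive; [repeat split; eexists; eassumption |].
    replace (Derive (fun y : R => P y) x) with (v x)
      by (symmetry; exact (is_derive_unique _ _ _ hdP)).
    replace (Derive (fun y : R => V y) x) with (u x)
      by (symmetry; exact (is_derive_unique _ _ _ hdV)).
    unfold V, opt_u; rewrite !clamp_id by lra; fold k; ring.
  - rewrite !clamp_id, hp0, hv0, hpm by lra; fold k; apply Rminus_diag_uniq; ring.
Qed.

Lemma unconstrained_optimal_control (t0 tm v0 pm : R) (p v u : R -> R) : t0 < tm ->
  unconstrained_optimal t0 tm v0 pm p v u ->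
  forall t, t0 <= t <= tm -> u t = opt_u t0 tm v0 pm t.
Proof.
  intros htm [hadm hmin] t ht.
  pose proof (opt_admissible t0 tm v0 pm htm) as hopt.
  pose proof (RInt_mul_opt_u _ _ _ _ _ _ _ htm hadm) as hint.
  pose proof (RInt_mul_opt_u _ _ _ _ _ _ _ htm hopt) as hintw.
  specialize (hmin _ _ _ hopt).
  destruct hadm as [_ _ hu _ _ _ _ _].
  pose (U := fun s => u (clamp t0 tm s)).
  pose (w := opt_u t0 tm v0 pm).
  fold w in hint, hmin, hintw.
  change (RInt (fun s => U s * w s) t0 tm = opt_slope t0 tm v0 pm * (pm - v0 * (tm - t0))) in hint.
  assert (hU : forall x, continuous U x) by (intros; apply continuous_clamp; [lra | exact hu]).
  assert (hw : forall x, continuous w x) by (intros; apply continuous_opt_u).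
  assert (hmul : forall (f g : R -> R), (forall x, continuous f x) ->
    (forall x, continuous g x) -> forall x, continuous (fun s => f s * g s) x)
    by (intros; apply (continuous_mult (K := R_AbsRing)); auto).
  assert (hsub : forall x, continuous (fun s => U s - w s) x)
    by (intros; apply (continuous_minus (V := R_NormedModule)); auto).
  assert (hex : forall f : R -> R, (forall x, continuous f x) -> ex_RInt f t0 tm)
    by (intros; apply (ex_RInt_continuous (V := R_CompleteNormedModule)); auto).
  rewrite (RInt_ext _ (fun s => w s * w s)) in hintw
    by (rewrite Rmin_left, Rmax_right by lra; intros s hs; rewrite clamp_id by lra; reflexivity).
  (* The cost sees only the open interval, so [u] may be traded for its continuous extension [U]. *)
  assert (hcost : forall f g : R -> R, (forall s, t0 < s < tm -> f s = g s) ->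
    (forall x, continuous g x) -> cost t0 tm f = / 2 * RInt (fun s => g s * g s) t0 tm).
  { intros f g hfg hg; unfold cost.
    transitivity (RInt (fun s => scal (/ 2) (g s * g s)) t0 tm); [apply RInt_ext |].
    - rewrite Rmin_left, Rmax_right by lra; intros s hs.
      rewrite hfg by assumption; unfold scal; simpl; unfold mult; simpl; ring.
    - apply (RInt_scal (V := R_CompleteNormedModule)); auto. }
  rewrite (hcost u U), (hcost w w) in hmin; auto.
  2: intros s hs; unfold U; now rewrite clamp_id by lra.
  assert (hsq : RInt (fun s => (U s - w s) * (U s - w s)) t0 tm =
    RInt (fun s => U s * U s) t0 tm - 2 * RInt (fun s => U s * w s) t0 tm
      + RInt (fun s => w s * w s) t0 tm).
  { apply is_RInt_unique.
    apply (is_RInt_ext (fun s => plus (minus (U s * U s) (scal 2 (U s * w s))) (w s * w s))).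
    - intros s _; unfold plus, minus, plus, opp, scal; simpl; unfold mult; simpl; ring.
    - apply (is_RInt_plus (V := R_NormedModule));
        [apply (is_RInt_minus (V := R_NormedModule));
           [| apply (is_RInt_scal (V := R_NormedModule))] |];
        apply (RInt_correct (V := R_CompleteNormedModule)); auto. }
  assert (h0 : (U t - w t) * (U t - w t) = 0).
  { apply (RInt_nonneg_eq0 (fun s => (U s - w s) * (U s - w s)) t0 tm); auto.
    - intros s; apply Rle_0_sqr.
    (* [hint] and [hintw] have the same right-hand side, which leaves half the integral as a
       difference of costs, nonpositive by [hmin]. *)
    - rewrite hsq; lra. }
  apply Rmult_integral in h0; unfold U in h0; rewrite clamp_id in h0 by lra; fold w; lra.
Qed.

(** Both speeds are antiderivatives of [opt_u] starting from [v0]. *)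
Lemma unconstrained_optimal_speed (t0 tm v0 pm : R) (p v u : R -> R) : t0 < tm ->
  unconstrained_optimal t0 tm v0 pm p v u ->
  forall t, t0 <= t <= tm -> v t = opt_v t0 tm v0 pm t.
Proof.
  intros htm hopt t ht.
  pose proof (unconstrained_optimal_control _ _ _ _ _ _ _ htm hopt) as hueq.
  destruct hopt as [[_ hv _ _ hdv _ hv0 _] _].
  assert (hle : t0 <= tm) by lra.
  assert (hfund : forall f : R -> R, (forall x, continuous f x) ->
    (forall x, t0 < x < tm -> is_derive f x (opt_u t0 tm v0 pm x)) ->
    RInt (opt_u t0 tm v0 pm) t0 t = f t - f t0).
  { intros f hf hd; apply RInt_derive_open; auto using continuous_opt_u; [lra |].
    intros x hx; apply hd; lra. }
  pose proof (hfund (fun s => v (clamp t0 tm s))) as h1.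
  pose proof (hfund (opt_v t0 tm v0 pm)) as h2.
  rewrite h1 in h2.
  - rewrite !clamp_id, hv0 in h2 by lra.
    assert (h3 : opt_v t0 tm v0 pm t0 = v0) by (unfold opt_v; field).
    rewrite h3 in h2.
    apply Rplus_eq_reg_r with (- v0), h2.
    + intros x; apply (ex_derive_continuous (V := R_NormedModule)).
      eexists; apply is_derive_opt_v.
    + intros x _; apply is_derive_opt_v.
  - intros x; now apply continuous_clamp.
  - intros x hx; rewrite <- hueq by lra; apply is_derive_clamp; auto.
Qed.

(** * Sign of the slope and the four constraints *)

(** A difference of squares; the cofactor of the slope is nonnegative on [[t0, tm]], so the slope
    decides on which side of [v0] the speed stays. *)
Lemma opt_v_sub_eq (t0 tm v0 pm t : R) :
  opt_v t0 tm v0 pm t - v0 =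
  opt_slope t0 tm v0 pm * ((t - t0) * ((tm - t0) + (tm - t)) / 2).
Proof. unfold opt_v; field. Qed.

(** The strict speed bounds handle [t0], where the speed is [v0] for any slope; the strict signs of
    [umin] and [umax] handle [tm], where the control is 0. The second part divides by [tm - t0],
    since [v0 > pm / tm] only yields [pm - v0 * (tm - t0) < v0 * t0], which does not make the slope
    negative when [v0 * t0 > 0]. *)
Theorem theorem1 (t0 tm v0 pm umin umax vmin vmax : R) (p v u : R -> R)
    (ht0 : 0 <= t0) (htm : t0 < tm)
    (hu : umin < 0 < umax)
    (hvmin : 0 <= vmin) (hv0 : vmin <= v0 <= vmax)
    (hopt : unconstrained_optimal t0 tm v0 pm p v u) :
  (v t0 < (p tm - p t0) / tm ->
     (vmin < v t0 -> ~ activated t0 tm (fun t => vmin - v t)) /\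
     ~ activated t0 tm (fun t => umin - u t))
  /\
  (v t0 > (p tm - p t0) / (tm - t0) ->
     (v t0 < vmax -> ~ activated t0 tm (fun t => v t - vmax)) /\
     ~ activated t0 tm (fun t => u t - umax)).
Proof.
  pose proof (unconstrained_optimal_control _ _ _ _ _ _ _ htm hopt) as hueq.
  pose proof (unconstrained_optimal_speed _ _ _ _ _ _ _ htm hopt) as hveq.
  destruct hopt as [[_ _ _ _ _ hp0 hvi hpm] _].
  rewrite hp0, hvi, hpm, Rminus_0_r.
  assert (hT : 0 < / (tm - t0) ^ 3) by (apply Rinv_0_lt_compat, pow_lt; lra).
  assert (hq : forall t, t0 <= t <= tm -> 0 <= (t - t0) * ((tm - t0) + (tm - t)) / 2)
    by (intros t ht; apply Rmult_le_pos; [apply Rmult_le_pos |]; lra).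
  split; intros hlt.
  - apply (Rmult_lt_compat_r tm) in hlt; [| lra].
    replace (pm / tm * tm) with pm in hlt by (field; lra).
    (* The hypothesis divides by [tm] instead of [tm - t0]; [v0, t0 >= 0] bridges the gap. *)
    assert (0 <= v0 * t0) by (apply Rmult_le_pos; lra).
    assert (hk : 0 <= opt_slope t0 tm v0 pm) by (apply Rmult_le_pos; lra).
    split; [intros hv |]; intros [t [ht hact]].
    + rewrite hveq in hact by assumption.
      pose proof (opt_v_sub_eq t0 tm v0 pm t).
      pose proof (Rmult_le_pos _ _ hk (hq t ht)); lra.
    + rewrite hueq in hact by assumption; unfold opt_u in hact.
      assert (0 <= tm - t) as h by lra.
      pose proof (Rmult_le_pos _ _ hk h); lra.
  - apply (Rmult_lt_compat_r (tm - t0)) in hlt; [| lra].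
    replace (pm / (tm - t0) * (tm - t0)) with pm in hlt by (field; lra).
    assert (hk : 0 <= - opt_slope t0 tm v0 pm).
    { unfold opt_slope, Rdiv; rewrite Ropp_mult_distr_l; apply Rmult_le_pos; lra. }
    split; [intros hv |]; intros [t [ht hact]].
    + rewrite hveq in hact by assumption.
      pose proof (opt_v_sub_eq t0 tm v0 pm t).
      pose proof (Rmult_le_pos _ _ hk (hq t ht)); lra.
    + rewrite hueq in hact by assumption; unfold opt_u in hact.
      assert (0 <= tm - t) as h by lra.
      pose proof (Rmult_le_pos _ _ hk h); lra.
Qed.
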